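(* Let $\mathcal{F}=\{\mathbf{f}_k\}_{k\in\mathbb{N}}$ be an orthogonal system in $S$, $\mathbf{f}_k=(f_{k,i})_{i\in\mathbb{N}}$, and let $V$ be a quadratic stochastic operator on $S$ with heredity coefficients $\{P_{ij,k}\}$ such that $V(\mathbf{e}_k)=\mathbf{f}_k$ for all $k\in\mathbb{N}$. Then $V$ is orthogonal preserving if and only if it has the following form, for every $\mathbf{x}\in S$: (a) for any $k\in\mathbb{N}$ and any $m\in supp(\mathbf{f}_k)$, $$V(\mathbf{x})_m=x_k\Big(f_{k,m}+\sum_{i=1}^\infty a_{ik}^{(m)}x_i\Big),$$ where $a_{ik}^{(m)}=2P_{ik,m}-f_{k,m}$ for $i\ne k$ and $a_{kk}^{(m)}=0$; (b) for any $c\in\mathcal{C}_{\mathcal{F}}=\mathbb{N}\setminus\bigcup_{k\in\mathbb{N}}supp(\mathbf{f}_k)$, $V(\mathbf{x})_c$ takes one of the following forms: (I) if $P_{ij,c}=0$ for all $i,j\in\mathbb{N}$, then $V(\mathbf{x})_c=0$; (II) if there exist $i_c,j_c\in\mathbb{N}$ with $P_{i_cj_c,c}>0$, then: (i) if there is no $i\in\mathbb{N}\setminus\{i_c,j_c\}$ and $j\in\{i_c,j_c\}$ with $P_{ij,c}>0$, then $V(\mathbf{x})_c=2P_{i_cj_c,c}x_{i_c}x_{j_c}$; (ii) if there exists $i_{c_0}\in\mathbb{N}\setminus\{i_c,j_c\}$ with $P_{i_{c_0}j,c}>0$ for $j=i_c$ or $j=j_c$ (where, interchanging the names of $i_c$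 and $j_c$ if necessary, $j=i_c$), then: (1) if $P_{i_{c_0}j_c,c}>0$, then $V(\mathbf{x})_c=2\big(P_{i_cj_c,c}x_{i_c}x_{j_c}+P_{i_{c_0}j_c,c}x_{i_{c_0}}x_{j_c}+P_{i_{c_0}i_c,c}x_{i_{c_0}}x_{i_c}\big)$; (2) if $P_{i_{c_0}j_c,c}=0$, then $V(\mathbf{x})_c=2x_{i_c}\Big(P_{i_cj_c,c}x_{j_c}+\sum_{i\ne i_c,j_c}P_{ii_c,c}x_i\Big)$.
   Context: $S=\{\mathbf{x}=(x_i)_{i\in\mathbb{N}}\in\mathbb{R}^{\mathbb{N}} : x_i\ge 0,\ \sum_{i}x_i=1\}$, and $\mathbf{e}_k=(\delta_{ik})_{i\in\mathbb{N}}$ is the standard basis. For $\mathbf{x}\in S$, $supp(\mathbf{x})=\{i\in\mathbb{N}: x_i\neq 0\}$; $\mathbf{x},\mathbf{y}\in S$ are orthogonal, $\mathbf{x}\perp\mathbf{y}$, if $supp(\mathbf{x})\cap supp(\mathbf{y})=\emptyset$. An orthogonal system is a sequence $\{\mathbf{f}_k\}_{k\in\mathbb{N}}$ in $S$ with $\mathbf{f}_k\perp\mathbf{f}_l$ for $k\ne l$. A quadratic stochastic operator (QSO) is a map $V:S\to S$ of the form $V(\mathbf{x})_k=\sum_{i,j\in\mathbb{N}}P_{ij,k}x_ix_j$, $k\in\mathbb{N}$, where the heredity coefficients satisfy $P_{ij,k}\ge 0$, $P_{ij,k}=P_{ji,k}$ and $\sum_{k\in\mathbb{N}}P_{ij,k}=1$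 for all $i,j,k\in\mathbb{N}$. A QSO $V$ is orthogonal preserving (OP) if $\mathbf{x}\perp\mathbf{y}$ implies $V(\mathbf{x})\perp V(\mathbf{y})$ for all $\mathbf{x},\mathbf{y}\in S$. *)

(* Defs.v *)
From HB Require Import structures.
From mathcomp Require Import all_boot all_order all_algebra.
From mathcomp Require Import all_classical all_reals all_analysis.

Set Implicit Arguments.
Unset Strict Implicit.
Unset Printing Implicit Defensive.

Import Order.TTheory GRing.Theory Num.Theory.
Import numFieldNormedType.Exports.

Local Open Scope classical_set_scope.
Local Open Scope ring_scope.

Section QuadraticStochasticOperators.
Variable R : realType.

Implicit Types (x y : R^nat) (f : nat -> R^nat) (P : nat -> nat -> nat -> R)
  (V : R^nat -> R^nat).

(* Indices range over nat, so the first coordinate has index 0.  Sums of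
   nonnegative terms are taken in \bar R, where they always exist. *)
Definition simplex : set R^nat :=
  [set x | (forall i, 0 <= x i) /\ (\sum_(0 <= i <oo) (x i)%:E = 1)%E].

Definition basis_vec (k : nat) : R^nat := fun i => (i == k)%:R.

Definition supp x : set nat := [set i | x i != 0].

Definition orthogonal x y : Prop := supp x `&` supp y = set0.

Definition orthogonal_system f : Prop :=
  (forall k, simplex (f k)) /\ (forall k l, k <> l -> orthogonal (f k) (f l)).

(* P i j k stands for P_{ij,k}. *)
Definition heredity P : Prop :=
  [/\ forall i j k, 0 <= P i j k,
      forall i j k, P i j k = P j i k &
      forall i j, (\sum_(0 <= k <oo) (P i j k)%:E = 1)%E].

(* V is a total function on sequences, but only its restriction to the simplex
   is constrained; the double sum is the unordered sum over nat * nat. *)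
Definition QSO P V : Prop :=
  [/\ heredity P,
      forall x, simplex x -> simplex (V x) &
      forall x, simplex x -> forall k,
        (V x k)%:E =
          \esum_(ij in [set: nat * nat]) (P ij.1 ij.2 k * x ij.1 * x ij.2)%:E].

Definition orthogonal_preserving V : Prop :=
  forall x y, simplex x -> simplex y -> orthogonal x y ->
    orthogonal (V x) (V y).

(* coef_a P f i k m is a_{ik}^{(m)}. *)
Definition coef_a P f (i k m : nat) : R :=
  if i == k then 0 else 2 * P i k m - f k m.

Definition uncovered f : set nat := ~` \bigcup_k supp (f k).

End QuadraticStochasticOperators.

Arguments simplex {R}.
Arguments basis_vec {R}.

(* Main.v *)
Require Import Defs.
From mathcomp Require Import all_boot all_order all_algebra.
From mathcomp Require Import all_classical all_reals all_analysis.
From mathcomp Require Import ring.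

Import Order.TTheory GRing.Theory Num.Theory.
Import numFieldNormedType.Exports.

Local Open Scope classical_set_scope.
Local Open Scope ring_scope.


(* For each coordinate m, call {i, j} an edge (a loop if i = j) when
   P_{ij,m} > 0.  On the simplex, V(x)_m > 0 exactly when the support of x
   contains an edge, so V is orthogonal preserving iff, for every m, any two
   edges intersect.  The loops are the k with m in supp(f_k): one loop at k
   forces all edges through k (a star), and rewriting x_k as
   1 - sum_{i != k} x_i in the star formula gives (a).  Without loops, an
   intersecting family of edges is empty, a star or a triangle, which gives (b).
   Conversely, each of the formulas vanishes at x or at y when x and y are
   orthogonal. *)

(** * Real series, and unordered double sums supported on one row and one column *)

Section Series.
Set Implicit Arguments.
Unset Strict Implicit.
Variable R : realType.
Implicit Types (u v : nat -> R) (g : nat * nat -> \bar R).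

Lemma cvg_seriesD u v a b : series u @ \oo --> a -> series v @ \oo --> b ->
  series (fun i => u i + v i) @ \oo --> a + b.
Proof.
move=> ua vb; have -> : series (fun i => u i + v i) = series u \+ series v.
  by apply/funext => n; rewrite /series /= big_split.
exact: cvgD.
Qed.

Lemma cvg_seriesZ u a c : series u @ \oo --> a ->
  series (fun i => c * u i) @ \oo --> c * a.
Proof.
move=> ua; have -> : series (fun i => c * u i) = (fun n => c * series u n).
  by apply/funext => n; rewrite /series /= mulr_sumr.
exact: cvgMr.
Qed.

(** Adding such a one-term series corrects another series at a single index; excluded terms are
    removed this way below. *)
Lemma cvg_series_delta k (a : R) :
  series (fun i => if i == k then a else 0) @ \oo --> a.
Proof.
apply: cvg_near_cst; exists k.+1 => // n /= kn.
by rewrite /series /= -big_mkcond big_nat1_eq /= kn.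
Qed.

(** Carries a limit computed in the reals over to the unordered sums that define a QSO. *)
Lemma esum_series u (s : R) : (forall i, 0 <= u i) -> series u @ \oo --> s ->
  \esum_(i in [set: nat]) (u i)%:E = s%:E.
Proof.
move=> u0 us; rewrite -nneseries_esumT; last by move=> i; rewrite lee_fin.
have -> : (fun n => \sum_(0 <= i < n) (u i)%:E)%E = EFin \o series u.
  by apply/funext => n; rewrite /series /= sumEFin.
rewrite EFin_lim; last by apply/cvg_ex; exists s.
by congr EFin; exact: cvg_lim.
Qed.

(** The column is the image of [nat] under the injection [i |-> (i, k)], so the sum can be
    reindexed; the row case is similar. *)
Lemma esum_column g k : (forall i j, j != k -> g (i, j) = 0%E) ->
  \esum_(ij in [set: nat * nat]) g ij = \esum_(i in [set: nat]) g (i, k).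
Proof.
move=> g0; rewrite -(@esum_image _ _ _ [set: nat] (fun i => (i, k)) g).
  rewrite [RHS]esum_mkcond; apply: eq_esum => -[i j] _.
  case: ifPn => // /negP ij; apply: g0; apply/negP => /eqP jk.
  by apply: ij; rewrite inE; exists i => //; rewrite jk.
by move=> i j _ _ [].
Qed.

Lemma esum_row g k : (forall i j, i != k -> g (i, j) = 0%E) ->
  \esum_(ij in [set: nat * nat]) g ij = \esum_(j in [set: nat]) g (k, j).
Proof.
move=> g0; rewrite -(@esum_image _ _ _ [set: nat] (fun j => (k, j)) g).
  rewrite [RHS]esum_mkcond; apply: eq_esum => -[i j] _.
  case: ifPn => // /negP ij; apply: g0; apply/negP => /eqP ik.
  by apply: ij; rewrite inE; exists j => //; rewrite ik.
by move=> i j _ _ [].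
Qed.

Lemma esum_term_le g ij : (g ij <= \esum_(t in [set: nat * nat]) g t)%E.
Proof.
by apply: esum_ge; exists [set ij]; [split => //|rewrite fsbig_set1].
Qed.

(** All nonzero entries lie in row [k] or column [k]. By symmetry each of these sums to [x k * s];
    the diagonal entry lies in both and must be counted once. *)
Lemma esum_quad_star (Q : nat -> nat -> R) (x : nat -> R) k (s : R) :
  (forall i j, 0 <= Q i j) -> (forall i j, Q i j = Q j i) ->
  (forall i, 0 <= x i) ->
  (forall i j, 0 < Q i j -> i = k \/ j = k) ->
  series (fun i => Q i k * x i) @ \oo --> s ->
  \esum_(ij in [set: nat * nat]) (Q ij.1 ij.2 * x ij.1 * x ij.2)%:E =
  (x k * (2 * s - Q k k * x k))%:E.
Proof.
move=> Q0 QC x0 Qk ks.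
have t0 i j : 0 <= Q i j * x i * x j by rewrite !mulr_ge0.
(* The diagonal entry is assigned to column [k], which leaves row [k] without it. *)
rewrite (eq_esum (b := fun ij =>
  ((if ij.2 == k then Q ij.1 ij.2 * x ij.1 * x ij.2 else 0)%:E +
   (if ij.2 == k then 0 else Q ij.1 ij.2 * x ij.1 * x ij.2)%:E)%E)); last first.
  by move=> [i j] _ /=; case: ifP => _; rewrite ?adde0 ?add0e.
rewrite esumD; [|by move=> [i j] _ /=; rewrite lee_fin; case: ifP..].
rewrite (esum_column (k := k)); last by move=> i j /= /negPf ->.
rewrite (esum_row (k := k)) /=; last first.
  move=> i j ik; case: ifPn => // jk; have [/Qk[]/eqP|] := ltP 0 (Q i j).
  - by rewrite (negPf ik).
  - by rewrite (negPf jk).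
  - by move=> le0; rewrite (_ : Q i j = 0) ?mul0r//; apply/eqP; rewrite eq_le le0 Q0.
have ks' : series (fun i => x k * (Q i k * x i)) @ \oo --> x k * s.
  exact: cvg_seriesZ.
rewrite (@esum_series _ (x k * s)); last 2 first.
- by move=> i; rewrite eqxx.
- rewrite (_ : (fun i => _) = (fun i => x k * (Q i k * x i)))//.
  by apply/funext => i; rewrite eqxx mulrC.
(* The remaining row is the full row plus a correction cancelling its diagonal term. *)
rewrite (@esum_series _ (x k * s + - (x k * (Q k k * x k)))); last 2 first.
- by move=> i; case: ifP.
- rewrite (_ : (fun i => _) = (fun i => x k * (Q i k * x i) +
      if i == k then - (x k * (Q k k * x k)) else 0)); last first.
    apply/funext => i; case: eqP => [->|_]; first by rewrite subrr.
    by rewrite addr0 QC mulrA mulrAC [_ * x k]mulrC mulrA.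
  by apply: cvg_seriesD => //; exact: cvg_series_delta.
by rewrite -EFinD; congr EFin; ring.
Qed.

End Series.

(** * Points of the simplex and their series *)

Section Simplex.
Set Implicit Arguments.
Unset Strict Implicit.
Variable R : realType.
Implicit Types (x : nat -> R).

Lemma simplexP x : (forall i, 0 <= x i) -> series x @ \oo --> (1 : R) ->
  simplex x.
Proof.
move=> x0 x1; split=> //; rewrite nneseries_esumT ?(esum_series x0 x1)//.
Qed.

Lemma simplex_cvg x : simplex x -> series x @ \oo --> (1 : R).
Proof.
move=> [x0 x1].
have := @is_cvg_nneseries R (fun i => (x i)%:E) xpredT 0%N
  (fun n _ _ => x0 n : (0 <= (x n)%:E)%E).
rewrite /= x1 => /fine_cvgP[_].
rewrite (_ : fine \o _ = series x)//.
by apply/funext => n; rewrite /= /series /= sumEFin.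
Qed.

Lemma simplex_le1 x k : simplex x -> x k <= 1.
Proof.
move=> sx; have [x0 _] := sx; have c := simplex_cvg sx.
(* Partial sums stop before their bound, so [k.+1] is the first that includes [x k]. *)
apply: (@le_trans _ _ (series x k.+1)).
  by rewrite /series /= big_nat_recr //= lerDr sumr_ge0.
rewrite -(cvg_lim _ c)//; apply: nondecreasing_cvgn_le.
  by apply/nondecreasing_seqP => n; rewrite /series /= big_nat_recr //= lerDl.
by apply/cvg_ex; exists 1.
Qed.

Lemma simplex_weighted_cvg x (q : nat -> R) : simplex x ->
  (forall i, 0 <= q i <= 1) -> cvgn (series (fun i => q i * x i)).
Proof.
move=> sx q01; have [x0 _] := sx.
apply: (@series_le_cvg _ _ x) => //.
- by move=> n; have /andP[q0 _] := q01 n; rewrite mulr_ge0.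
- by move=> n; have /andP[_ q1] := q01 n; rewrite ler_piMl.
- by apply/cvg_ex; exists 1; exact: simplex_cvg.
Qed.

(** Test point with support exactly the edge [{i, j}]; for a loop [i = j] it is the basis vector
    itself. *)
Definition midpoint (i j : nat) : nat -> R :=
  fun n => 2^-1 * (basis_vec i n + basis_vec j n).

Lemma basis_vec_ge0 i n : 0 <= basis_vec i n :> R.
Proof. exact: ler0n. Qed.

Lemma basis_vec_cvg i : series (@basis_vec R i) @ \oo --> (1 : R).
Proof.
rewrite (_ : basis_vec i = fun n => if n == i then 1 else 0).
  exact: cvg_series_delta.
by apply/funext => n; rewrite /basis_vec; case: eqP.
Qed.

Lemma basis_vec_simplex i : simplex (@basis_vec R i).
Proof. by apply: simplexP; [exact: basis_vec_ge0|exact: basis_vec_cvg]. Qed.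

Lemma midpoint_simplex i j : simplex (midpoint i j).
Proof.
apply: simplexP => [n|].
  by rewrite mulr_ge0 ?invr_ge0 ?addr_ge0 ?basis_vec_ge0.
rewrite [X in _ --> X](_ : 1 = 2^-1 * (1 + 1)); last by field.
by apply: cvg_seriesZ; apply: cvg_seriesD; exact: basis_vec_cvg.
Qed.

Lemma midpointl_gt0 i j : 0 < midpoint i j i.
Proof.
by rewrite mulr_gt0 ?invr_gt0// {1}/basis_vec eqxx ltr_wpDr ?basis_vec_ge0.
Qed.

Lemma midpointr_gt0 i j : 0 < midpoint i j j.
Proof.
by rewrite mulr_gt0 ?invr_gt0// {2}/basis_vec eqxx ltr_wpDl ?basis_vec_ge0.
Qed.

Lemma supp_midpoint i j n : supp (midpoint i j) n -> n = i \/ n = j.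
Proof.
rewrite /supp /= /midpoint /basis_vec.
case: (eqVneq n i) => [|_]; first by left.
case: (eqVneq n j) => [|_]; first by right.
by rewrite addr0 mulr0 eqxx.
Qed.

End Simplex.

(** * Values of a QSO when the edges at a coordinate form a star or a triangle *)

Section Operator.
Set Implicit Arguments.
Unset Strict Implicit.
Variables (R : realType) (P : nat -> nat -> nat -> R).
Variables (V : (nat -> R) -> (nat -> R)) (QV : QSO P V).
Implicit Types (x : nat -> R).

Lemma heredity_ge0 i j m : 0 <= P i j m.
Proof. by case: QV => -[]. Qed.

Lemma heredityC i j m : P i j m = P j i m.
Proof. by case: QV => -[]. Qed.

(** For fixed [i] and [j], the sequence [P i j] is itself a point of the simplex. *)
Lemma heredity_le1 i j m : P i j m <= 1.
Proof.
case: QV => -[P0 _ P1] _ _.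
by apply: (@simplex_le1 _ (P i j) m); split.
Qed.

Lemma heredity_eq0 i j m : ~ 0 < P i j m -> P i j m = 0.
Proof.
move=> /negP; rewrite -leNgt => le0.
by apply/eqP; rewrite eq_le le0 heredity_ge0.
Qed.

(** Ensures that [limn] in the star formula is a genuine limit and not a default value. *)
Lemma QSO_cvg x k m : simplex x -> cvgn (series (fun i => P i k m * x i)).
Proof.
move=> sx; apply: (@simplex_weighted_cvg _ _ (fun i => P i k m)) => // i.
by rewrite heredity_ge0 heredity_le1.
Qed.

Lemma QSO_star x k m : simplex x ->
  (forall i j, 0 < P i j m -> i = k \/ j = k) ->
  V x m = x k * (2 * limn (series (fun i => P i k m * x i)) - P k k m * x k).
Proof.
move=> sx km; have [_ _ VE] := QV; have [x0 _] := sx.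
apply: EFin_inj; rewrite VE//.
apply: (esum_quad_star (Q := fun i j => P i j m)) => //.
- by move=> i j; exact: heredity_ge0.
- by move=> i j; exact: heredityC.
- exact: QSO_cvg.
Qed.

(** Together with V(e_k) = f_k this identifies f_{k,m} with P_{kk,m}, so the loops at [m] are read
    off the supports of the f_k. *)
Lemma QSO_basis_vec k m : V (basis_vec k) m = P k k m.
Proof.
have [_ _ VE] := QV.
apply: EFin_inj; rewrite VE; last exact: basis_vec_simplex.
rewrite (@esum_column _ _ k); last first.
  by move=> i j /negPf jk; rewrite /= {2}/basis_vec jk mulr0.
apply: esum_series => [i|]; first by rewrite !mulr_ge0 ?heredity_ge0 ?ler0n.
rewrite (_ : (fun i => _) = fun i => if i == k then P k k m else 0).
  exact: cvg_series_delta.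
apply/funext => i; rewrite /= /basis_vec eqxx.
by case: eqP => [->|_]; rewrite ?mulr0 ?mulr1// mul0r.
Qed.

Lemma QSO_gt0 x i j m : simplex x -> 0 < P i j m -> 0 < x i -> 0 < x j ->
  0 < V x m.
Proof.
move=> sx Pij xi xj; have [_ _ VE] := QV.
rewrite -lte_fin VE//; apply: lt_le_trans (esum_term_le _ (i, j)).
by rewrite lte_fin /= !mulr_gt0.
Qed.

(** Disjoint edges would have orthogonal midpoints, while the images of both midpoints are positive
    at [m]. *)
Lemma OP_intersecting i j k l m : orthogonal_preserving V ->
  0 < P i j m -> 0 < P k l m -> [\/ k = i, k = j, l = i | l = j].
Proof.
move=> OP Pij Pkl; apply: contrapT => nI.
have o : Defs.orthogonal (midpoint R i j) (midpoint R k l).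
  apply/seteqP; split=> // n [/supp_midpoint ni /supp_midpoint nk].
  by apply: nI; case: ni => <-; case: nk => <-;
    [apply: Or41|apply: Or43|apply: Or42|apply: Or44].
have /seteqP[+ _] := OP _ _ (midpoint_simplex _ _ _) (midpoint_simplex _ _ _) o.
apply; split; apply/lt0r_neq0.
- exact: (QSO_gt0 (midpoint_simplex _ _ _) Pij
    (midpointl_gt0 _ _ _) (midpointr_gt0 _ _ _)).
- exact: (QSO_gt0 (midpoint_simplex _ _ _) Pkl
    (midpointl_gt0 _ _ _) (midpointr_gt0 _ _ _)).
Qed.

(* A triangle is the star around [a] together with the single edge [{b, c}]. *)
Lemma QSO_triangle x a b c m : simplex x -> a != b -> a != c -> b != c ->
  (forall i, P i i m = 0) ->
  (forall i j, 0 < P i j m -> [/\ i = a \/ i = b \/ i = c &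
                                 j = a \/ j = b \/ j = c]) ->
  V x m = 2 * (P a b m * x a * x b + P c b m * x c * x b + P c a m * x c * x a).
Proof.
move=> sx ab ac bc Pl Pabc; have [_ _ VE] := QV; have [x0 _] := sx.
have Pout i j : i != a -> i != b -> i != c -> P i j m = 0.
  move=> ia ib ic; apply: heredity_eq0 => /Pabc[+ _].
  by case=> [/eqP|[] /eqP]; apply/negP.
pose Q1 i j := if (i == a) || (j == a) then P i j m else 0.
pose Q2 i j := if (i == a) || (j == a) then 0 else P i j m.
have Q10 i j : 0 <= Q1 i j by rewrite /Q1; case: ifP => // _; exact: heredity_ge0.
have Q20 i j : 0 <= Q2 i j by rewrite /Q2; case: ifP => // _; exact: heredity_ge0.
have Q1C i j : Q1 i j = Q1 j i by rewrite /Q1 orbC heredityC.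
have Q2C i j : Q2 i j = Q2 j i by rewrite /Q2 orbC heredityC.
apply: EFin_inj; rewrite VE//.
rewrite (eq_esum (b := fun ij => ((Q1 ij.1 ij.2 * x ij.1 * x ij.2)%:E +
   (Q2 ij.1 ij.2 * x ij.1 * x ij.2)%:E)%E)); last first.
  by move=> [i j] _ /=; rewrite /Q1 /Q2; case: ifP; rewrite !mul0r ?adde0 ?add0e.
rewrite esumD; [|by move=> [i j] _; rewrite lee_fin !mulr_ge0..].
rewrite (@esum_quad_star _ Q1 x a (P b a m * x b + P c a m * x c)) //; last 2 first.
- move=> i j; rewrite /Q1; case: ifPn; last by rewrite ltxx.
  by move=> /orP[] /eqP ->; [left|right].
- rewrite (_ : (fun i => _) = (fun i =>
    (if i == b then P b a m * x b else 0) +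
    (if i == c then P c a m * x c else 0))).
    by apply: cvg_seriesD; exact: cvg_series_delta.
  apply/funext => i; rewrite /Q1 eqxx orbT.
  case: (eqVneq i b) => [->|ib]; first by rewrite (negPf bc) addr0.
  case: (eqVneq i c) => [->|ic]; first by rewrite add0r.
  case: (eqVneq i a) => [->|ia]; first by rewrite Pl mul0r addr0.
  by rewrite Pout// mul0r addr0.
(* The edge [{b, c}] left over is treated as a star around [b] with the single leaf [c]. *)
rewrite (@esum_quad_star _ Q2 x b (P c b m * x c)) //; last 2 first.
- move=> i j; rewrite /Q2; case: ifPn; first by rewrite ltxx.
  rewrite negb_or => /andP[/eqP ia /eqP ja] Pij.
  have [[//|[->|ic]] [//|[->|jc]]] := Pabc _ _ Pij; [by left|by left|by right|].
  by move: Pij; rewrite ic jc Pl ltxx.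
- rewrite (_ : (fun i => _) = (fun i => if i == c then P c b m * x c else 0)).
    exact: cvg_series_delta.
  apply/funext => i; rewrite /Q2 [b == a]eq_sym (negPf ab) orbF.
  case: (eqVneq i a) => [->|ia]; first by rewrite (negPf ac) mul0r.
  case: (eqVneq i c) => [->//|ic].
  case: (eqVneq i b) => [->|ib]; first by rewrite Pl mul0r.
  by rewrite Pout// mul0r.
rewrite -EFinD; congr EFin; rewrite /Q1 /Q2 eqxx [b == a]eq_sym (negPf ab) /= !Pl.
by rewrite [P b a m]heredityC; ring.
Qed.

End Operator.




Theorem theorem3p4 (R : realType) (f : nat -> nat -> R)
    (P : nat -> nat -> nat -> R) (V : (nat -> R) -> (nat -> R)) :
  orthogonal_system f ->
  QSO P V ->
  (forall k : nat, V (basis_vec k) = f k) ->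
  (orthogonal_preserving V <->
   forall x : nat -> R, simplex x ->
     (forall k m : nat, supp (f k) m ->
        V x m = x k * (f k m +
          \big[+%R/0]_(0 <= i <oo) (coef_a P f i k m * x i))) /\
     (forall c : nat, uncovered f c ->
        ((forall i j : nat, P i j c = 0) -> V x c = 0) /\
        (forall ic jc : nat, 0 < P ic jc c ->
           (~ (exists i j : nat, [/\ i <> ic, i <> jc, j = ic \/ j = jc &
                 0 < P i j c]) ->
            V x c = 2 * P ic jc c * x ic * x jc) /\
           (forall ic0 : nat, ic0 <> ic -> ic0 <> jc -> 0 < P ic0 ic c ->
              (0 < P ic0 jc c ->
               V x c = 2 * (P ic jc c * x ic * x jc +
                            P ic0 jc c * x ic0 * x jc +
                            P ic0 ic c * x ic0 * x ic)) /\
              (P ic0 jc c = 0 ->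
               V x c = 2 * x ic * (P ic jc c * x jc +
                 \big[+%R/0]_(0 <= i <oo | (i != ic) && (i != jc))
                    (P i ic c * x i))))))).
Proof.
move=> _ QV Vf.
have Pf k m : P k k m = f k m by rewrite -(QSO_basis_vec QV) Vf.

(* Sufficiency: operators of the given form preserve orthogonality *)
split=> [OP x sx|H x y sx sy xy]; last first.
  have o n : x n = 0 \/ y n = 0.
    apply: contrapT => /not_orP[/eqP xn /eqP yn].
    by have /seteqP[+ _] := xy; apply; split; [exact: xn|exact: yn].
  apply/seteqP; split=> // m [/eqP Vx /eqP Vy].
  have [[k _ fkm]|cm] := pselect ((\bigcup_k supp (f k)) m).
    have [[+ _] [+ _]] := (H x sx, H y sy).
    move=> /(_ k m fkm) Vxm /(_ k m fkm) Vym.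
    by case: (o k) => k0; [apply: Vx; rewrite Vxm k0 mul0r
                          |apply: Vy; rewrite Vym k0 mul0r].
  have [[_ +] [_ +]] := (H x sx, H y sy).
  move=> /(_ m cm)[Hx0 Hx] /(_ m cm)[_ Hy].
  have [P0|] := pselect (forall i j, P i j m = 0); first exact: Vx (Hx0 P0).
  move=> /existsNP[a /existsNP[b /eqP Pab]].
  have {Pab} : 0 < P a b m by rewrite lt0r Pab (heredity_ge0 QV).
  have [[i [j [ia ib jab Pij]]] Pab|nE Pab] := pselect (exists i j : nat,
      [/\ i <> a, i <> b, j = a \/ j = b & 0 < P i j m]); last first.
    have [Vxm _] := Hx _ _ Pab; have [Vym _] := Hy _ _ Pab.
    by case: (o a) => a0; [apply: Vx; rewrite (Vxm nE) a0 mulr0 mul0r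
                          |apply: Vy; rewrite (Vym nE) a0 mulr0 mul0r].
  (* The situation is symmetric in [a] and [b]: this is the interchange of the names of i_c and
     j_c. *)
  wlog ja : a b ia ib jab Pab / j = a.
    move=> W; case: (jab) => [|jb]; first exact: (W a b).
    apply: (W b a) => //; first by case: jab => ->; [right|left].
    by rewrite (heredityC QV).
  rewrite {}ja in Pij.
  have [_ /(_ i ia ib Pij)[Vx1 Vx2]] := Hx _ _ Pab.
  have [_ /(_ i ia ib Pij)[Vy1 Vy2]] := Hy _ _ Pab.
  have [Pib|/(heredity_eq0 QV) Pib] := pselect (0 < P i b m); last first.
    by case: (o a) => a0; [apply: Vx; rewrite (Vx2 Pib) a0 mulr0 mul0r
                          |apply: Vy; rewrite (Vy2 Pib) a0 mulr0 mul0r].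
  (* Pigeonhole: [x] or [y] vanishes at two of the three vertices. *)
  move: (Vx1 Pib) (Vy1 Pib).
  by case: (o a) => a0; case: (o b) => b0; case: (o i) => i0 Ex Ey;
    first [by apply: Vx; rewrite Ex ?a0 ?b0 ?i0 !(mulr0, mul0r, addr0)
          |by apply: Vy; rewrite Ey ?a0 ?b0 ?i0 !(mulr0, mul0r, addr0)].

(* Necessity: intersecting edges yield the formulas *)
have int i j k l m : 0 < P i j m -> 0 < P k l m ->
    [\/ k = i, k = j, l = i | l = j] by exact: (OP_intersecting QV).
split=> [k m fkm|c cf].
  rewrite (@QSO_star _ _ _ QV x k); [|exact: sx|]; last first.
    have Pkk : 0 < P k k m by rewrite lt0r Pf fkm -Pf (heredity_ge0 QV).
    by move=> i j /(int _ _ _ _ _ Pkk)[]; [left|left|right|right].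
  set s := limn (series _).
  (* The factor 1 is the total mass of [x]. The last term accounts for a_kk = 0, since the general
     expression would give 2 P_{kk,m} - f_{k,m} = f_{k,m} at i = k. *)
  have -> : \big[+%R/0]_(0 <= i <oo) (coef_a P f i k m * x i) =
      2 * s + - f k m * 1 + - (f k m * x k).
    apply: cvg_lim => //.
    rewrite (_ : (fun n => _) = series (fun i => 2 * (P i k m * x i) +
        - f k m * x i + if i == k then - (f k m * x k) else 0)).
      apply: cvg_seriesD; last exact: cvg_series_delta.
      apply: cvg_seriesD; apply: cvg_seriesZ; last exact: simplex_cvg.
      exact: (QSO_cvg QV).
    apply/funext => n; apply: eq_bigr => i _; rewrite /coef_a.
    by case: eqP => [->|_]; rewrite ?Pf; ring.
  by rewrite Pf; ring.
(* An uncovered coordinate has no loops. *)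
have Pl i : P i i c = 0.
  by rewrite Pf; apply: contrapT => /eqP fic; apply: cf; exists i.
split=> [P0|a b Pab].
  (* Without edges any centre will do; 0 is arbitrary. *)
  rewrite (@QSO_star _ _ _ QV x 0%N); [|exact: sx|]; last first.
    by move=> i j; rewrite P0 ltxx.
  rewrite (_ : (fun i => _) = fun i => 0 * x i); last first.
    by apply/funext => i; rewrite P0.
  rewrite (cvg_lim _ (cvg_seriesZ (c := 0) (simplex_cvg sx)))// Pl.
  by rewrite !mul0r mulr0 subr0 mulr0.
have ab : a != b by apply/eqP => ab; move: Pab; rewrite ab Pl ltxx.
split=> [nE|d da db Pda].
  (* No edge joins [a] or [b] to a third vertex, so [{a, b}] is the only edge: a star around [a]
     with one leaf. *)
  have Pa i : i != b -> P i a c = 0.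
    move=> ib; case: (eqVneq i a) => [->//|ia].
    apply: (heredity_eq0 QV) => Pia; apply: nE; exists i, a.
    by split=> //; [exact/eqP|exact/eqP|left].
  have Pb i : i != a -> P i b c = 0.
    move=> ia; case: (eqVneq i b) => [->//|ib].
    apply: (heredity_eq0 QV) => Pib; apply: nE; exists i, b.
    by split=> //; [exact/eqP|exact/eqP|right].
  rewrite (@QSO_star _ _ _ QV x a); [|exact: sx|]; last first.
    move=> i j Pij; apply: contrapT => /not_orP[/eqP ia /eqP ja].
    case: (int _ _ _ _ _ Pab Pij) => E; move: Pij ia ja; rewrite E ?eqxx //.
      by rewrite (heredityC QV) => + _ ja; rewrite Pb// ltxx.
    by move=> + ia _; rewrite Pb// ltxx.
  rewrite (_ : (fun i => _) = fun i => if i == b then P b a c * x b else 0).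
    rewrite (cvg_lim _ (@cvg_series_delta _ _ _))// Pl (heredityC QV b a).
    by ring.
  by apply/funext => i; case: eqP => [->//|/eqP ib]; rewrite Pa// mul0r.
move/eqP in da; move/eqP in db.
split=> [Pdb|Pdb].
  rewrite (@QSO_triangle _ _ _ QV x a b d c)//; [by rewrite eq_sym|by rewrite eq_sym|].
  (* An edge that is not a loop and meets all three sides of a triangle has both ends among its
     vertices. *)
  move=> i j Pij; have := int _ _ _ _ _ Pdb Pij; have := int _ _ _ _ _ Pda Pij.
  have := int _ _ _ _ _ Pab Pij.
  have nij : i <> j by move=> ij; move: Pij; rewrite ij Pl ltxx.
  have [nab nda ndb] : [/\ a <> b, d <> a & d <> b] by split; exact/eqP.
  by move=> [] ? [] ? [] ?; split; first [congruence|subst; tauto].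
rewrite (@QSO_star _ _ _ QV x a); [|exact: sx|]; last first.
  (* An edge avoiding [a] but meeting [{a, b}] and [{d, a}] would be [{b, d}], which is excluded by
     [Pdb]. *)
  move=> i j Pij; apply: contrapT => /not_orP[ia ja].
  have ndb : ~ (i = d /\ j = b) by move=> [E1 E2]; move: Pij; rewrite E1 E2 Pdb ltxx.
  have nbd : ~ (i = b /\ j = d).
    by move=> [E1 E2]; move: Pij; rewrite E1 E2 (heredityC QV) Pdb ltxx.
  move/eqP: db => db.
  have := int _ _ _ _ _ Pda Pij; have := int _ _ _ _ _ Pab Pij.
  by move=> [] ? [] ?; first [congruence|subst; tauto].
set s := limn (series _).
(* Only the term at [b] has to be subtracted, as the one at [a] is a loop and vanishes. *)
have -> : \big[+%R/0]_(0 <= i <oo | (i != a) && (i != b)) (P i a c * x i) =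
    s + - (P b a c * x b).
  apply: cvg_lim => //.
  rewrite (_ : (fun n => _) = series (fun i => P i a c * x i +
      if i == b then - (P b a c * x b) else 0)).
    apply: cvg_seriesD; last exact: cvg_series_delta.
    exact: (QSO_cvg QV).
  apply/funext => n; rewrite big_mkcond; apply: eq_bigr => i _.
  case: (eqVneq i a) => [->|ia] /=; first by rewrite Pl mul0r (negPf ab) addr0.
  by case: eqP => [->|_] /=; rewrite ?subrr ?addr0.
by rewrite Pl (heredityC QV b a); ring.
Qed.
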